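(* Let $W=\mathrm{Frac}(\mathbb Q[\mathbb R_+^\times])$ be the field of fractions of the rational group ring of the multiplicative group $\mathbb R_+^\times$ of positive reals. Let $\tau_W:\mathbb R\to W$ be given by the canonical inclusion $x\mapsto\tau_W(x)\in\mathbb Q[\mathbb R_+^\times]$ for $x>0$, $\tau_W(0)=0$ and $\tau_W(-x)=-\tau_W(x)$. Let $\rho_W:W\to\mathbb R^\flat$ be defined by $\rho_W(0)=0$ and $$\rho_W\Big(\sum_i\alpha_i\tau_W(x_i)\Big/\sum_j\beta_j\tau_W(y_j)\Big)=\mathrm{sign}\Big(\frac{\alpha_0}{\beta_0}\Big)\frac{x_0}{y_0},$$ where the $x_i>0$ are distinct, the $y_j>0$ are distinct, $\alpha_i,\beta_j\in\mathbb Q\setminus\{0\}$, $x_0=\sup\{x_i\}$ and $y_0=\sup\{y_j\}$. Then the triple $(W,\rho_W,\tau_W)$ is the universal $W$-model for the real tropical hyperfield $\mathbb R^\flat$. Moreover the homomorphism $\rho_W$ induces an isomorphism of hyperfields $W/G\xrightarrow{\sim}\mathbb R^\flat$, where $G=\ker(\rho_W:W^\times\to(\mathbb R^\flat)^\times)$.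
   Context: A hyperfield is a set $H$ with distinct elements $0,1$, a commutative associative multiplication for which $H\setminus\{0\}$ is an abelian group with unit $1$ and $0\cdot x=0$, and a multivalued addition $(x,y)\mapsto x+y$ with values non-empty subsets of $H$, which is commutative, associative, satisfies $x+0=\{x\}$, has for each $x$ a unique $-x$ with $0\in x+(-x)$, satisfies $x\in y+z\Rightarrow z\in x+(-y)$, and is distributive. A field is a hyperfield with single-valued addition. A homomorphism of hyperfields is a map $f$ with $f(0)=0$, $f(1)=1$, $f(xy)=f(x)f(y)$ and $f(x+y)\subset f(x)+f(y)$; an isomorphism is a bijective homomorphism with $f(x+y)=f(x)+f(y)$. The real tropical hyperfield $\mathbb R^\flat$ is the set $\mathbb R$ with its usual multiplication and the hyperaddition $x\smile y=x$ if $|x|>|y|$ or $x=y$; $x\smile y=y$ if $|x|<|y|$; $x\smile y=[-|x|,|x|]$ if $y=-x$. For a field $K$ and a subgroup $G\subset K^\times$, the quotient hyperfield $K/G$ is the set of orbits of $G$ acting on $K$ by multiplication, with the induced multiplication and the hyperaddition $xG+_G yG=\{(X+Y)G\mid X\in xG,\ Y\in yG\}$. A $W$-model of a hyperfield $H$ is a triple $(K,\rho,\tau)$ where $K$ is a field, $\rho:K\to H$ is a homomorphism of hyperfields, and $\tau:H\to K$ is a multiplicative section of $\rho$ (a multiplicative map with $\rho\circ\tau=\mathrm{id}$). A morphism $(K_1,\rho_1,\tau_1)\to(K_2,\rho_2,\tau_2)$ of $W$-models is a field homomorphism $\alpha:K_1\to K_2$ such that $\tau_2=\alpha\circ\tau_1$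 and $\rho_1=\rho_2\circ\alpha$. A $W$-model of $H$ is universal if there exists a unique morphism from it to any other $W$-model of $H$. *)

(* Defs.v *)
From HB Require Import structures.
From mathcomp Require Import all_boot all_order all_algebra.
From mathcomp Require Import finmap.
From mathcomp.multinomials Require Import monalg.
From mathcomp Require Import boolp classical_sets set_interval reals.
From mathcomp Require Import ring lra.

Set Implicit Arguments.
Unset Strict Implicit.
Unset Printing Implicit Defensive.

Import Order.TTheory GRing.Theory Num.Theory.

Local Open Scope classical_set_scope.
Local Open Scope ring_scope.

(* hopp_eq below makes hopp x the unique y with 0 in x + y; the union over u of
   x + u (resp. u + z) is the hypersum of an element and a set.  *)
Record hyperfield := Hyperfield {
  hcarrier :> Type;
  hzero : hcarrier;
  hone : hcarrier;
  hmul : hcarrier -> hcarrier -> hcarrier;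
  hadd : hcarrier -> hcarrier -> set hcarrier;
  hopp : hcarrier -> hcarrier;
  hzero_neq_one : hzero <> hone;
  hmulA : associative hmul;
  hmulC : commutative hmul;
  hmul1 : left_id hone hmul;
  hmul0 : left_zero hzero hmul;
  hmul_neq0 : forall x y, x <> hzero -> y <> hzero -> hmul x y <> hzero;
  hmul_inv : forall x, x <> hzero -> exists2 y, y <> hzero & hmul y x = hone;
  hadd_neq0 : forall x y, hadd x y !=set0;
  haddC : commutative hadd;
  haddA : forall x y z,
    \bigcup_(u in hadd y z) hadd x u = \bigcup_(u in hadd x y) hadd u z;
  hadd0 : forall x, hadd x hzero = [set x];
  haddN : forall x, hadd x (hopp x) hzero;
  hopp_eq : forall x y, hadd x y hzero -> y = hopp x;
  hadd_rev : forall x y z, hadd y z x -> hadd x (hopp y) z;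
  hmulDr : forall x y z, hmul x @` hadd y z = hadd (hmul x y) (hmul x z)
}.

Arguments hzero {_}.
Arguments hone {_}.
Arguments hmul {_}.
Arguments hadd {_}.
Arguments hopp {_}.

Definition hyper_hom (H1 H2 : hyperfield) (f : H1 -> H2) : Prop :=
  [/\ f hzero = hzero,
      f hone = hone,
      (forall x y, f (hmul x y) = hmul (f x) (f y)) &
      (forall x y, f @` hadd x y `<=` hadd (f x) (f y))].

Definition hyper_iso (H1 H2 : hyperfield) (f : H1 -> H2) : Prop :=
  [/\ hyper_hom f, bijective f &
      (forall x y, f @` hadd x y = hadd (f x) (f y))].

Section FieldHyperfield.
Variable K : fieldType.

Definition field_add (x y : K) : set K := [set x + y].

Program Definition field_hyperfield : hyperfield :=
  @Hyperfield K 0 1 *%R field_add -%R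
    _ (@mulrA K) (@mulrC K) (@mul1r K) (@mul0r K) _ _ _ _ _ _ _ _ _ _.
Next Obligation. by apply/eqP; rewrite eq_sym oner_eq0. Qed.
Next Obligation. by apply/eqP; rewrite mulf_neq0//; apply/eqP. Qed.
Next Obligation.
by move/eqP: H => x0; exists x^-1; [apply/eqP; rewrite invr_eq0|rewrite mulVf].
Qed.
Next Obligation. by exists (x + y). Qed.
Next Obligation. by move=> x y; rewrite /field_add addrC. Qed.
Next Obligation. by rewrite /field_add !bigcup_set1 addrA. Qed.
Next Obligation. by rewrite /field_add addr0. Qed.
Next Obligation. by rewrite /field_add/= subrr. Qed.
Next Obligation.
by move: H; rewrite /field_add/= => /esym/eqP; rewrite addrC addr_eq0 => /eqP.
Qed.
Next Obligation. by move: H; rewrite /field_add/= => ->; rewrite addrC addKr. Qed.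
Next Obligation. by rewrite /field_add image_set1 mulrDr. Qed.

End FieldHyperfield.

Section RealTropical.
Variable R : realType.
Implicit Types x y z : R.

Definition trop_add x y : set R :=
  if (`|y| < `|x|) || (x == y) then [set x]
  else if `|x| < `|y| then [set y]
  else `[- `|x|, `|x|]%classic.

Lemma trop_addE x y z : trop_add x y z <->
  [\/ z = x /\ (`|y| < `|x| \/ x = y), z = y /\ `|x| < `|y|
    | y = - x /\ `|z| <= `|x|].
Proof.
rewrite /trop_add; have [->|xy] := eqVneq x y.
  rewrite orbT; split => [->|]; first by constructor 1; split => //; right.
  case=> -[//].
  move=> /eqP; rewrite -addr_eq0 -mulr2n mulrn_eq0/= => /eqP->.
  by rewrite normr0 normr_le0 => /eqP.
rewrite orbF; case: ltgtP => h/=.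
- split=> [->|]; first by constructor 1; split => //; left.
  by case=> -[//] yx; move: h; rewrite yx normrN ltxx.
- split=> [->|]; first by constructor 2.
  case=> -[//] => [_ [//|/eqP]|yx]; first by rewrite (negbTE xy).
  by move: h; rewrite yx normrN ltxx.
- have yx : y = - x.
    move/esym/eqP: h; rewrite eqr_norm2 => /orP[|/eqP->]; last by rewrite opprK.
    by rewrite (negbTE xy).
  rewrite in_itv/= -ler_norml; split=> [zx|]; first by constructor 3.
  by case=> -[//] _ [//|/eqP]; rewrite (negbTE xy).
Qed.

Lemma trop_addl x y : `|y| <= `|x| -> trop_add x y x.
Proof.
move=> yx; apply/trop_addE; move: yx; rewrite le_eqVlt => /orP[|yx].
  rewrite eqr_norm2 => /orP[]/eqP->; first by constructor 1; split => //; right.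
  by constructor 3.
by constructor 1; split => //; left.
Qed.

Lemma trop_addN x y : trop_add x (- x) y <-> `|y| <= `|x|.
Proof.
split=> [/trop_addE[[-> //]|[->]|[]//]|yx]; first by rewrite normrN ltxx.
by apply/trop_addE; constructor 3.
Qed.

Lemma trop_addC : commutative trop_add.
Proof.
move=> x y; apply/seteqP; split=> z /trop_addE h; apply/trop_addE;
  case: h => -[].
- by move=> -> [|<-]; [constructor 2|constructor 1; split=> //; right].
- by move=> -> ?; constructor 1; split=> //; left.
- by move=> -> zx; constructor 3; rewrite opprK normrN.
- by move=> -> [|<-]; [constructor 2|constructor 1; split=> //; right].
- by move=> -> ?; constructor 1; split=> //; left.
- by move=> -> zx; constructor 3; rewrite opprK normrN.
Qed.

Lemma trop_addr x y : `|x| <= `|y| -> trop_add x y y.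
Proof. by rewrite trop_addC; exact: trop_addl. Qed.

Lemma trop_addxx x : trop_add x x = [set x].
Proof. by rewrite /trop_add eqxx orbT. Qed.

Lemma trop_add0 x : trop_add x 0 = [set x].
Proof.
rewrite /trop_add normr0 normr_gt0; case: eqVneq => //= -> .
Qed.

Lemma trop_add_neq0 x y : trop_add x y !=set0.
Proof.
have [xy|yx] := leP `|x| `|y|; first by exists y; exact: trop_addr.
by exists x; apply: trop_addl; exact: ltW.
Qed.

Lemma trop_opp x y : trop_add x y 0 -> y = - x.
Proof.
case/trop_addE => [[x0]|[y0]|[]//].
  by rewrite -x0 normr0 ltNge normr_ge0/= => -[//|<-]; rewrite oppr0.
by rewrite -y0 normr0 ltNge normr_ge0.
Qed.

Lemma trop_add_rev x y z : trop_add y z x -> trop_add x (- y) z.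
Proof.
case/trop_addE => [[->] [zy|<-]|[-> yz]|[-> xy]].
- by apply/trop_addN; exact: ltW.
- by apply: (iffRL (trop_addN _ _)).
- by apply: trop_addl; rewrite normrN ltW.
- by apply: trop_addr; rewrite normrN.
Qed.

Lemma trop_addA_sub x y z w u : trop_add x y u -> trop_add u z w ->
  exists2 v, trop_add y z v & trop_add x v w.
Proof.
case/trop_addE => [[-> yx]|[-> xy]|[-> ux]].
- case/trop_addE => [[-> zx]|[-> xz]|[-> wx]].
  + have [zy|yz] := ltP `|z| `|y|.
      exists y; first exact/trop_addl/ltW.
      by case: yx => [/ltW yx|<-]; [exact: trop_addl|rewrite trop_addxx].
    exists z; first exact: trop_addr.
    by case: zx => [/ltW zx|<-]; [exact: trop_addl|rewrite trop_addxx].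
  + exists z; last exact/trop_addr/ltW.
    by apply/trop_addr/ltW; case: yx => [yx|<- //]; exact: lt_trans xz.
  + exists (- x); last exact/trop_addN.
    by apply: trop_addr; rewrite normrN; case: yx => [/ltW|<-].
- case/trop_addE => [[-> zy]|[-> yz]|[-> wy]].
  + exists y; last exact/trop_addr/ltW.
    by apply: trop_addl; case: zy => [/ltW|<-].
  + exists z; first exact/trop_addr/ltW.
    by apply/trop_addr/ltW; exact: lt_trans yz.
  + have [wx|xw] := leP `|w| `|x|.
      by exists (- x); apply/trop_addN => //; rewrite normrN ltW.
    by exists w; [exact/trop_addN|exact/trop_addr/ltW].
- move=> uzw; have [zx|xz] := leP `|z| `|x|.
    exists (- x); first by apply: trop_addl; rewrite normrN.
    by apply/trop_addN; case/trop_addE: uzw => [[->]//|[->]//|[_ /le_trans]]; exact.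
  exists z; first by apply/trop_addr; rewrite normrN ltW.
  case/trop_addE: uzw => [[_ [|uz]]|[-> _]|[zu _]].
  + by move=> /(lt_trans xz); rewrite ltNge ux.
  + by move: xz; rewrite -uz ltNge ux.
  + exact/trop_addr/ltW.
  + by move: xz; rewrite zu normrN ltNge ux.
Qed.

Lemma trop_addA x y z :
  \bigcup_(u in trop_add y z) trop_add x u =
  \bigcup_(u in trop_add x y) trop_add u z.
Proof.
apply/seteqP; split=> w [u uP wP].
  rewrite trop_addC in uP; rewrite trop_addC in wP.
  have [v] := trop_addA_sub uP wP.
  by rewrite trop_addC => vP; rewrite trop_addC => ?; exists v.
by have [v vP ?] := trop_addA_sub uP wP; exists v.
Qed.

Lemma trop_mulDr x y z :
  *%R x @` trop_add y z = trop_add (x * y) (x * z).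
Proof.
have [->|x0] := eqVneq x 0.
  rewrite !mul0r trop_addxx; apply/seteqP; split=> [_ [u _ <-]|_ ->].
    by rewrite mul0r.
  by have [u uP] := trop_add_neq0 y z; exists u; rewrite ?mul0r.
suff H (a b c d : R) : a != 0 -> trop_add b c d -> trop_add (a * b) (a * c) (a * d).
  apply/seteqP; split=> [_ [u uP <-]|u uP]; first exact: H.
  exists (x^-1 * u); last by rewrite mulVKf.
  have := H x^-1 _ _ _ _ uP.
  by rewrite !mulKf// invr_eq0; exact.
move=> a0 /trop_addE h; apply/trop_addE.
have na : 0 < `|a| by rewrite normr_gt0.
rewrite !normrM !ltr_pM2l// ler_pM2l//; case: h => -[-> h].
- by constructor 1; split => //; case: h => [?|->]; [left|right].
- by constructor 2.
- by constructor 3; rewrite mulrN.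
Qed.

Program Definition real_tropical : hyperfield :=
  @Hyperfield R 0 1 *%R trop_add -%R
    _ (@mulrA R) (@mulrC R) (@mul1r R) (@mul0r R) _ _
    trop_add_neq0 trop_addC trop_addA trop_add0 _ trop_opp trop_add_rev
    trop_mulDr.
Next Obligation. by apply/eqP; rewrite eq_sym oner_eq0. Qed.
Next Obligation. by apply/eqP; rewrite mulf_neq0//; apply/eqP. Qed.
Next Obligation.
by move/eqP: H => x0; exists x^-1; [apply/eqP; rewrite invr_eq0|rewrite mulVf].
Qed.
Next Obligation. by apply/trop_addN; rewrite normr0. Qed.

End RealTropical.

(* Subgroups of the multiplicative group of K, as subsets of K. *)
Record unit_subgroup (K : fieldType) := UnitSubgroup {
  usg_set :> set K;
  usg_neq0 : ~ usg_set 0;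
  usg1 : usg_set 1;
  usgM : forall x y, usg_set x -> usg_set y -> usg_set (x * y);
  usgV : forall x, usg_set x -> usg_set x^-1
}.

Section QuotientHyperfield.
Variables (K : fieldType) (G : unit_subgroup K).
Implicit Types x y z : K.
Local Notation inG := (usg_set G).

Definition unit_orbit x : set K := [set x * g | g in usg_set G].

Definition unit_orbits : Type := {A : set K | exists x, A = unit_orbit x}.

Definition to_orbit x : unit_orbits := exist _ (unit_orbit x) (ex_intro _ x erefl).

Definition quot_mul_set (A B : set K) : set K :=
  [set x * y | x in A & y in B].

Lemma orbitP x y : unit_orbit x y <-> unit_orbit x = unit_orbit y.
Proof.
split=> [[g Gg <-]|->]; last by exists 1; rewrite ?mulr1//; exact: usg1.
have g0 : g != 0 by apply/eqP => g0; apply: (usg_neq0 (u := G)); rewrite -g0.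
apply/seteqP; split=> [_ [h Gh <-]|_ [h Gh <-]].
  exists (g^-1 * h); last by rewrite mulrA mulfK.
  by apply: usgM => //; exact: usgV.
by exists (g * h); rewrite ?mulrA//; exact: usgM.
Qed.

Lemma orbits_inj (A B : unit_orbits) : sval A = sval B -> A = B.
Proof. by case: A B => [A p] [B q]/= e; subst B; congr exist; exact: Prop_irrelevance. Qed.

Lemma to_orbitP x y : to_orbit x = to_orbit y <-> exists2 g, inG g & y = x * g.
Proof.
split=> [[/orbitP[g Gg <-]]|[g Gg ->]]; first by exists g.
by apply/orbits_inj/orbitP; exists g.
Qed.

Lemma to_orbit_surj (A : unit_orbits) : exists x, A = to_orbit x.
Proof. by case: A => A [x Ax]; exists x; apply: orbits_inj. Qed.

Lemma orbit_mul x y : quot_mul_set (unit_orbit x) (unit_orbit y) = unit_orbit (x * y).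
Proof.
apply/seteqP; split=> [_ [_ [g Gg <-]] [_ [h Gh <-]] <-|_ [g Gg <-]].
  by exists (g * h); [exact: usgM|rewrite mulrACA].
exists (x * g); first by exists g.
by exists y; [exists 1; [exact: usg1|rewrite mulr1]|rewrite mulrAC].
Qed.

Lemma quot_mul_subproof (A B : unit_orbits) :
  exists x, quot_mul_set (sval A) (sval B) = unit_orbit x.
Proof.
case: A B => [A [x Ax]] [B [y By]]; exists (x * y) => /=.
by rewrite Ax By; exact: orbit_mul.
Qed.

Definition quot_mul (A B : unit_orbits) : unit_orbits :=
  exist _ (quot_mul_set (sval A) (sval B)) (quot_mul_subproof A B).

Definition quot_add (A B : unit_orbits) : set unit_orbits :=
  [set to_orbit (x + y) | x in sval A & y in sval B].

Lemma quot_opp_subproof (A : unit_orbits) : exists x, -%R @` sval A = unit_orbit x.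
Proof.
case: A => [A [x Ax]]; exists (- x) => /=; rewrite Ax.
apply/seteqP; split=> [_ [_ [g Gg <-] <-]|_ [g Gg <-]].
  by exists g; rewrite ?mulNr.
by exists (x * g); [exists g|rewrite mulNr].
Qed.

Definition quot_opp (A : unit_orbits) : unit_orbits :=
  exist _ (-%R @` sval A) (quot_opp_subproof A).

Lemma to_orbitM x y : quot_mul (to_orbit x) (to_orbit y) = to_orbit (x * y).
Proof. by apply: orbits_inj; rewrite /= orbit_mul. Qed.

Lemma to_orbitN x : quot_opp (to_orbit x) = to_orbit (- x).
Proof.
apply: orbits_inj => /=; apply/seteqP.
split=> [_ [_ [g Gg <-] <-]|_ [g Gg <-]].
  by exists g; rewrite ?mulNr.
by exists (x * g); [exists g|rewrite mulNr].
Qed.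

Lemma quot_addP x y z : quot_add (to_orbit x) (to_orbit y) (to_orbit z) <->
  exists g h, [/\ inG g, inG h & z = x * g + y * h].
Proof.
split=> [[_ [g Gg <-]] [_ [h Gh <-]] /to_orbitP[k Gk ->]|[g [h [Gg Gh ->]]]].
  by exists (g * k), (h * k); rewrite mulrDl !mulrA; split => //; exact: usgM.
by exists (x * g); [exists g|exists (y * h); [exists h|]].
Qed.

Lemma usg_unit g : inG g -> g != 0.
Proof. by move=> Gg; apply/eqP => g0; apply: (usg_neq0 (u := G)); rewrite -g0. Qed.

Lemma to_orbit_eq0 x : to_orbit x = to_orbit 0 -> x = 0.
Proof. by move/esym/to_orbitP => [g _ ->]; rewrite mul0r. Qed.

Lemma quot_mul_inv A : A <> to_orbit 0 ->
  exists2 B, B <> to_orbit 0 & quot_mul B A = to_orbit 1.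
Proof.
have [x ->] := to_orbit_surj A => x0.
have {}x0 : x != 0 by apply/eqP => xe; apply: x0; rewrite xe.
exists (to_orbit x^-1); last by rewrite to_orbitM mulVf.
by move=> /to_orbit_eq0/eqP; rewrite invr_eq0 (negbTE x0).
Qed.

Lemma quot_addC : commutative quot_add.
Proof.
move=> A B; apply/seteqP; split=> _ [x Ax] [y By] <-;
  by exists y => //; exists x => //; rewrite addrC.
Qed.

Lemma quot_addA_sub A B C U V : quot_add A B U -> quot_add U C V ->
  exists2 W, quot_add B C W & quot_add A W V.
Proof.
have [x ->] := to_orbit_surj A; have [y ->] := to_orbit_surj B.
have [z ->] := to_orbit_surj C; have [u ->] := to_orbit_surj U.
have [v ->] := to_orbit_surj V.
move=> /quot_addP[g [h [Gg Gh ->]]] /quot_addP[k [l [Gk Gl ->]]].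
exists (to_orbit (y * (h * k) + z * l)).
  by apply/quot_addP; exists (h * k), l; split => //; exact: usgM.
apply/quot_addP; exists (g * k), 1; split; [exact: usgM|exact: usg1|].
by rewrite mulr1 mulrDl !mulrA addrA.
Qed.

Lemma quot_addA A B C : \bigcup_(u in quot_add B C) quot_add A u =
  \bigcup_(u in quot_add A B) quot_add u C.
Proof.
apply/seteqP; split=> W [U UP WP].
  rewrite quot_addC in UP; rewrite quot_addC in WP.
  have [V] := quot_addA_sub UP WP.
  by rewrite quot_addC => VP; rewrite quot_addC => ?; exists V.
by have [V VP ?] := quot_addA_sub UP WP; exists V.
Qed.

Lemma quot_mulDr A B C :
  quot_mul A @` quot_add B C = quot_add (quot_mul A B) (quot_mul A C).
Proof.
have [x ->] := to_orbit_surj A; have [y ->] := to_orbit_surj B.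
have [z ->] := to_orbit_surj C; rewrite !to_orbitM.
apply/seteqP; split=> [_ [U UP <-]|U UP]; have [u Uu] := to_orbit_surj U; subst U.
  move/quot_addP : UP => [g [h [Gg Gh ->]]]; rewrite to_orbitM.
  by apply/quot_addP; exists g, h; rewrite mulrDr !mulrA.
move/quot_addP : UP => [g [h [Gg Gh ->]]].
exists (to_orbit (y * g + z * h)); first by apply/quot_addP; exists g, h.
by rewrite to_orbitM mulrDr !mulrA.
Qed.

Program Definition quotient_hyperfield : hyperfield :=
  @Hyperfield unit_orbits (to_orbit 0) (to_orbit 1) quot_mul quot_add quot_opp
    _ _ _ _ _ _ quot_mul_inv _ quot_addC quot_addA _ _ _ _ quot_mulDr.
Next Obligation. by move=> /esym/to_orbit_eq0/eqP; rewrite oner_eq0. Qed.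
Next Obligation.
move=> A B C; have [x ->] := to_orbit_surj A; have [y ->] := to_orbit_surj B.
by have [z ->] := to_orbit_surj C; rewrite !to_orbitM mulrA.
Qed.
Next Obligation.
move=> A B; have [x ->] := to_orbit_surj A; have [y ->] := to_orbit_surj B.
by rewrite !to_orbitM mulrC.
Qed.
Next Obligation.
by move=> A; have [x ->] := to_orbit_surj A; rewrite to_orbitM mul1r.
Qed.
Next Obligation.
by move=> A; have [x ->] := to_orbit_surj A; rewrite to_orbitM mul0r.
Qed.
Next Obligation.
have [a ?] := to_orbit_surj x; have [b ?] := to_orbit_surj y; subst x y.
rewrite to_orbitM => /to_orbit_eq0/eqP; rewrite mulf_eq0.
by case/orP=> /eqP e; [apply: H|apply: H0]; rewrite e.
Qed.
Next Obligation.
have [a ->] := to_orbit_surj x; have [b ->] := to_orbit_surj y.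
exists (to_orbit (a + b)); apply/quot_addP; exists 1, 1.
by rewrite !mulr1; split => //; exact: usg1.
Qed.
Next Obligation.
have [a ->] := to_orbit_surj x; apply/seteqP; split=> [U|_ ->].
  have [u ->] := to_orbit_surj U => /quot_addP[g [h [Gg Gh ->]]].
  by rewrite mul0r addr0; apply/esym/to_orbitP; exists g.
apply/quot_addP; exists 1, 1; rewrite mul0r addr0 mulr1.
by split => //; exact: usg1.
Qed.
Next Obligation.
have [a ->] := to_orbit_surj x; rewrite to_orbitN.
by apply/quot_addP; exists 1, 1; rewrite !mulr1 subrr; split => //; exact: usg1.
Qed.
Next Obligation.
have [a ?] := to_orbit_surj x; have [b ?] := to_orbit_surj y; subst x y.
move/quot_addP : H => [g [h [Gg Gh /esym/eqP]]].
rewrite addr_eq0 to_orbitN => /eqP agbh; apply/to_orbitP.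
exists (h / g); first by apply: usgM => //; exact: usgV.
by rewrite mulrA -[b * h]opprK -agbh mulNr mulfK//; exact: usg_unit.
Qed.
Next Obligation.
have [a ?] := to_orbit_surj x; have [b ?] := to_orbit_surj y.
have [c ?] := to_orbit_surj z; subst x y z; rewrite to_orbitN.
move/quot_addP : H => [g [h [Gg Gh ->]]]; have h0 := usg_unit Gh.
apply/quot_addP; exists h^-1, (g / h).
split; [exact: usgV|by apply: usgM => //; exact: usgV|].
by field.
Qed.

End QuotientHyperfield.

Arguments to_orbit {K} G x.

Definition kernel_set (K : fieldType) (H : hyperfield) (f : K -> H) : set K :=
  [set x | x != 0 /\ f x = hone].

Section Kernel.
Variables (K : fieldType) (H : hyperfield) (f : field_hyperfield K -> H).
Hypothesis f_hom : hyper_hom f.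

Lemma kernel_neq0 : ~ kernel_set f 0.
Proof. by move=> [/eqP]. Qed.

Lemma kernel1 : kernel_set f 1.
Proof. by case: f_hom => _ f1 _ _; split => //; exact: oner_neq0. Qed.

Lemma kernelM x y : kernel_set f x -> kernel_set f y -> kernel_set f (x * y).
Proof.
case: f_hom => _ _ fM _ [x0 fx] [y0 fy].
by split; [rewrite mulf_neq0|rewrite (fM x y) fx fy hmul1].
Qed.

Lemma kernelV x : kernel_set f x -> kernel_set f x^-1.
Proof.
case: f_hom => _ f1 fM _ [x0 fx]; split; first by rewrite invr_eq0.
by have := fM x x^-1; rewrite /= (divff x0) [f 1]f1 fx hmul1 => <-.
Qed.

Definition kernel : unit_subgroup K :=
  UnitSubgroup kernel_neq0 kernel1 kernelM kernelV.

End Kernel.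

Record W_model (H : hyperfield) := WModel {
  W_field : fieldType;
  W_rho : field_hyperfield W_field -> H;
  W_tau : H -> W_field;
  W_rho_hom : hyper_hom W_rho;
  W_tauM : forall x y, W_tau (hmul x y) = W_tau x * W_tau y;
  W_tauK : cancel W_tau W_rho
}.

Arguments W_rho {H} _ _.
Arguments W_tau {H} _ _.

Definition W_morphism (H : hyperfield) (M N : W_model H)
    (alpha : {rmorphism W_field M -> W_field N}) : Prop :=
  (forall x, W_tau N x = alpha (W_tau M x)) /\
  (forall x, W_rho M x = W_rho N (alpha x)).

Definition universal_W_model (H : hyperfield) (M : W_model H) : Prop :=
  forall N : W_model H,
    exists2 alpha : {rmorphism W_field M -> W_field N}, W_morphism alpha &
      forall beta : {rmorphism W_field M -> W_field N},
        W_morphism beta -> beta =1 alpha.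

(* The ring structure that monalg puts on {malg A[M]} requires that 1 be the only
   invertible monomial, so it does not apply to groups. *)
Section GroupRing.
Variables (A : comNzRingType) (G : groupType).

Definition group_ring : Type := {malg A[G]}.

HB.instance Definition _ := GRing.Lmodule.on group_ring.

Implicit Types f g h : group_ring.

Definition gr_one : group_ring := << 1 *g (1%g : G) >>.

Definition gr_mul f g : group_ring :=
  \sum_(x <- msupp f) \sum_(y <- msupp g) << f@_x * g@_y *g (x * y)%g >>.

Lemma gr_mulw (d1 d2 : {fset G}) f g :
  (msupp f `<=` d1)%fset -> (msupp g `<=` d2)%fset ->
  gr_mul f g = \sum_(x <- d1) \sum_(y <- d2) << f@_x * g@_y *g (x * y)%g >>.
Proof.
move=> le_d1 le_d2; rewrite /gr_mul (big_fset_incl _ le_d1) /=.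
  apply/eq_bigr=> k1 _; apply/big_fset_incl => // k _ /mcoeff_outdom ->.
  by rewrite mulr0 monalgU0.
move=> k _ /mcoeff_outdom g1k.
by rewrite big1 => // k' _; rewrite g1k mul0r monalgU0.
Qed.

Lemma gr_mulUU (a b : A) (x y : G) :
  gr_mul << a *g x >> << b *g y >> = << a * b *g (x * y)%g >>.
Proof. by rewrite (gr_mulw msuppU_le msuppU_le) !big_seq_fset1 !mcoeffUU. Qed.

Lemma gr_mulDl : left_distributive gr_mul +%R.
Proof.
move=> g1 g2 g.
rewrite (gr_mulw (msuppD_le g1 g2) (fsubset_refl _)).
rewrite (gr_mulw (fsubsetUl (msupp g1) (msupp g2)) (fsubset_refl (msupp g))).
rewrite (gr_mulw (fsubsetUr (msupp g1) (msupp g2)) (fsubset_refl (msupp g))).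
rewrite -big_split /=; apply/eq_bigr=> k1 _.
rewrite -big_split /=; apply/eq_bigr=> k2 _.
by rewrite mcoeffD mulrDl monalgUD.
Qed.

Lemma gr_mulDr : right_distributive gr_mul +%R.
Proof.
move=> g g1 g2.
rewrite (gr_mulw (fsubset_refl _) (msuppD_le g1 g2)).
rewrite (gr_mulw (fsubset_refl (msupp g)) (fsubsetUl (msupp g1) (msupp g2))).
rewrite (gr_mulw (fsubset_refl (msupp g)) (fsubsetUr (msupp g1) (msupp g2))).
rewrite -big_split /=; apply/eq_bigr => k1 _.
rewrite -big_split /=; apply/eq_bigr => k2 _.
by rewrite mcoeffD mulrDr monalgUD.
Qed.

Lemma gr_mul0g : left_zero 0 gr_mul.
Proof. by move=> g; rewrite /gr_mul msupp0 big_seq_fset0. Qed.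

Lemma gr_mulg0 : right_zero 0 gr_mul.
Proof.
by move=> g; rewrite /gr_mul msupp0 big1 // => x _; rewrite big_seq_fset0.
Qed.

Lemma gr_mul_suml (I : Type) (r : seq I) (F : I -> group_ring) g :
  gr_mul (\sum_(i <- r) F i) g = \sum_(i <- r) gr_mul (F i) g.
Proof.
exact: (big_morph (gr_mul^~ g) (fun _ _ => gr_mulDl _ _ _) (gr_mul0g _)).
Qed.

Lemma gr_mul_sumr (I : Type) (r : seq I) (F : I -> group_ring) g :
  gr_mul g (\sum_(i <- r) F i) = \sum_(i <- r) gr_mul g (F i).
Proof.
exact: (big_morph (gr_mul g) (fun _ _ => gr_mulDr _ _ _) (gr_mulg0 _)).
Qed.

Lemma gr_mulEl f g : gr_mul f g = \sum_(x <- msupp f) gr_mul << f@_x *g x >> g.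
Proof.
apply: eq_bigr => x _; rewrite (gr_mulw msuppU_le (fsubset_refl _)).
by rewrite big_seq_fset1 mcoeffUU.
Qed.

Lemma gr_mulEr f g : gr_mul f g = \sum_(y <- msupp g) gr_mul f << g@_y *g y >>.
Proof.
rewrite /gr_mul exchange_big/=; apply: eq_bigr => y _.
rewrite -/(gr_mul f _) (gr_mulw (fsubset_refl _) msuppU_le).
by apply: eq_bigr => x _; rewrite big_seq_fset1 mcoeffUU.
Qed.

Lemma gr_mulA : associative gr_mul.
Proof.
move=> f g h; rewrite [RHS]gr_mul_suml gr_mulEl; apply: eq_bigr => x _.
rewrite [LHS]gr_mul_sumr [RHS]gr_mul_suml; apply: eq_bigr => y _.
rewrite [LHS]gr_mul_sumr gr_mulEr; apply: eq_bigr => z _.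
by rewrite !gr_mulUU mulrA mulgA.
Qed.

Lemma gr_mul1g : left_id gr_one gr_mul.
Proof.
move=> g; rewrite [in LHS](monalgE g) gr_mul_sumr [RHS]monalgE.
by apply: eq_bigr => x _; rewrite gr_mulUU mul1r mul1g.
Qed.

Lemma gr_mulg1 : right_id gr_one gr_mul.
Proof.
move=> g; rewrite [in LHS](monalgE g) gr_mul_suml [RHS]monalgE.
by apply: eq_bigr => x _; rewrite gr_mulUU mulr1 mulg1.
Qed.

Lemma gr_one_neq0 : gr_one != 0.
Proof. by rewrite /gr_one monalgU_eq0 oner_eq0. Qed.

HB.instance Definition _ := GRing.Zmodule_isNzRing.Build group_ring
  gr_mulA gr_mul1g gr_mulg1 gr_mulDl gr_mulDr gr_one_neq0.

Lemma gr_supp_mul f g x : x \in msupp (f * g) ->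
  exists y z, [/\ y \in msupp f, z \in msupp g & x = (y * z)%g].
Proof.
rewrite -mcoeff_neq0 => h; apply: contrapT => hn; move/eqP: h; apply.
rewrite raddf_sum/= big_seq big1// => y yf.
rewrite raddf_sum/= big_seq big1// => z zg.
rewrite mcoeffU; case: eqP => // e; exfalso; apply: hn.
by exists y, z.
Qed.

End GroupRing.

Lemma fraction_repr (D : idomainType) (w : {fraction D}) :
  w = FracField.tofrac \n_(repr w) / FracField.tofrac \d_(repr w).
Proof.
apply: (canRL (mulfK _)); first by rewrite tofrac_eq0 denom_ratioP.
rewrite -[w in LHS](@reprK _ {fraction D}); unlock FracField.tofrac.
rewrite -[LHS]FracField.pi_mul; apply/eqmodP => /=.
rewrite FracField.equivfE /FracField.mulf !numden_Ratio ?mulf_neq0 ?oner_eq0 ?denom_ratioP//.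
by rewrite !mulr1 reprK mulrC.
Qed.

Section PositiveReals.
Variable R : realType.

Definition posreal : Type := {x : R | 0 < x}.

HB.instance Definition _ := SubChoice.on posreal.

Implicit Types x y z : posreal.

Definition pos_one : posreal := exist _ 1 ltr01.
Definition pos_mul x y : posreal :=
  exist _ (val x * val y) (mulr_gt0 (valP x) (valP y)).
Definition pos_inv x : posreal :=
  exist _ (val x)^-1 (etrans (invr_gt0 (val x)) (valP x)).

Lemma pos_mulA : associative pos_mul.
Proof. by move=> x y z; apply: val_inj; rewrite /= mulrA. Qed.

Lemma pos_mulC : commutative pos_mul.
Proof. by move=> x y; apply: val_inj; rewrite /= mulrC. Qed.

Lemma pos_mul1 : left_id pos_one pos_mul.
Proof. by move=> x; apply: val_inj; rewrite /= mul1r. Qed.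

Lemma pos_mulr1 : right_id pos_one pos_mul.
Proof. by move=> x; apply: val_inj; rewrite /= mulr1. Qed.

Lemma pos_mulV : left_inverse pos_one pos_inv pos_mul.
Proof. by move=> x; apply: val_inj; rewrite /= mulVf// gt_eqF// (valP x). Qed.

Lemma pos_mulrV : right_inverse pos_one pos_inv pos_mul.
Proof. by move=> x; apply: val_inj; rewrite /= mulfV// gt_eqF// (valP x). Qed.

HB.instance Definition _ := isGroup.Build posreal
  pos_mulA pos_mul1 pos_mulr1 pos_mulV pos_mulrV.

Definition to_pos (r : R) : posreal := insubd (1%g : posreal) r.

Lemma to_posK (r : R) : 0 < r -> val (to_pos r) = r.
Proof. by move=> r0; rewrite val_insubd r0. Qed.

Lemma valK_pos x : to_pos (val x) = x.
Proof. by apply: val_inj; rewrite to_posK// (valP x). Qed.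

Definition QRpos : Type := group_ring rat posreal.

HB.instance Definition _ := GRing.NzRing.on QRpos.

Implicit Types f g : QRpos.

Lemma QRpos_mulC : @commutative QRpos _ *%R.
Proof.
move=> f g; rewrite /GRing.mul/= /gr_mul exchange_big/=.
apply: eq_bigr => y _; apply: eq_bigr => x _.
by rewrite [X in mkmalgU X _]pos_mulC mulrC.
Qed.

HB.instance Definition _ := GRing.PzRing_hasCommutativeMul.Build QRpos QRpos_mulC.

(* For f = sum_i a_i x_i with the a_i nonzero and the x_i distinct, lead_exp f is
   x_0 = sup x_i and lead_rat f is the coefficient a_0 of x_0; both are 0 when
   f = 0. *)
Definition lead_exp f : R := \big[Num.max/0]_(x <- msupp f) val x.

Definition lead_rat f : rat := f@_(to_pos (lead_exp f)).

Definition is_lead f (p : posreal) :=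
  p \in msupp f /\ forall x, x \in msupp f -> val x <= val p.

Lemma lead_expP f p : is_lead f p -> lead_exp f = val p.
Proof.
move=> [pf ub]; apply/le_anti/andP; split.
  rewrite /lead_exp big_seq; apply: (big_ind (fun t : R => t <= val p)) => [|a b ha hb|x xf].
  - exact/ltW/(valP p).
  - by rewrite ge_max ha hb.
  - exact: ub.
exact: le_bigmax_seq.
Qed.

Lemma lead_ratP f p : is_lead f p -> lead_rat f = f@_p.
Proof. by move=> /lead_expP fp; rewrite /lead_rat fp valK_pos. Qed.

Lemma lead_rat_neq0 f p : is_lead f p -> lead_rat f != 0.
Proof. by move=> fp; rewrite (lead_ratP fp) mcoeff_neq0; case: fp. Qed.

Lemma is_lead_ex f : f != 0 -> exists p, is_lead f p.
Proof.
move=> f0; suff [x0 x0f] : exists x, x \in msupp f.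
  have : forall s : seq posreal, s != [::] ->
      exists2 p, p \in s & forall x, x \in s -> val x <= val p.
    elim=> // a [|b s] ih _; first by exists a; rewrite ?inE// => x /[!inE]/eqP->.
    have [//|p ps pub] := ih; have [ap|pa] := leP (val a) (val p).
      exists p => [|x]; rewrite in_cons; [by rewrite ps orbT|by move=> /predU1P[->//|/pub]].
    exists a => [|x]; rewrite in_cons ?eqxx// => /predU1P[->//|/pub xp].
    exact/(le_trans xp)/ltW.
  move=> /(_ (msupp f)) [|p pf pub]; last by exists p.
  by apply: contraTneq x0f => s0; rewrite -[_ \in _]/(x0 \in (msupp f : seq _)) s0.
apply: contrapT => h; move/eqP: f0; apply; apply/malgP => x.
by rewrite mcoeff0 mcoeff_outdom//; apply/negP => xf; apply: h; exists x.
Qed.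

Lemma is_leadM f g p q : is_lead f p -> is_lead g q ->
  is_lead (f * g) (p * q)%g /\ (f * g)@_(p * q)%g = f@_p * g@_q.
Proof.
move=> fp gq; have [pf fub] := fp; have [qg gub] := gq.
have uniq_pq x y : x \in msupp f -> y \in msupp g ->
    (x * y == p * q)%g -> x = p /\ y = q.
  move=> xf yg /eqP/(congr1 val)/= e.
  have xp := fub _ xf; have yq := gub _ yg.
  have [x0 y0] := (valP x, valP y); have [p0 q0] := (valP p, valP q).
  have xe : val x = val p.
    apply/le_anti; rewrite xp/= leNgt; apply/negP => xltp.
    suff : val x * val y < val p * val q by rewrite e ltxx.
    by apply: (lt_le_trans (_ : _ < val p * val y)); rewrite ?ltr_pM2r ?ler_pM2l.
  split; apply: val_inj => //.
  by move: e; rewrite xe => /mulfI; apply; rewrite gt_eqF.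
have fgpq : (f * g)@_(p * q)%g = f@_p * g@_q.
  rewrite raddf_sum/= (big_fsetD1 p)//= raddf_sum/= (big_fsetD1 q)//=.
  rewrite mcoeffUU big_seq big1 ?addr0 => [|y].
    rewrite big_seq big1 ?addr0// => x; rewrite !inE => /andP[xp xf].
    rewrite raddf_sum/= big_seq big1// => y yg; rewrite mcoeffU.
    by case: eqP => // /eqP/uniq_pq[]// /eqP; rewrite (negbTE xp).
  rewrite !inE => /andP[yq yg]; rewrite mcoeffU.
  by case: eqP => // /eqP/uniq_pq[]// _ /eqP; rewrite (negbTE yq).
split => //; split.
  by rewrite -mcoeff_neq0 fgpq mulf_neq0// mcoeff_neq0.
move=> x /gr_supp_mul[y [z [yf zg ->]]] /=.
apply: ler_pM; [exact/ltW/(valP y)|exact/ltW/(valP z)|exact: fub|exact: gub].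
Qed.

Lemma QRpos_integral f g : f * g = 0 -> (f == 0) || (g == 0).
Proof.
move=> fg0; apply/norP => -[/is_lead_ex[p fp] /is_lead_ex[q gq]].
by have [[]] := is_leadM fp gq; rewrite fg0 msupp0.
Qed.

Definition QRpos_unit : pred QRpos := fun f => `[< exists g, g * f = 1 >].

Definition QRpos_inv f : QRpos :=
  if pselect (exists g, g * f = 1) is left e then projT1 (cid e) else f.

Lemma QRpos_mulVf : {in QRpos_unit, left_inverse 1 QRpos_inv *%R}.
Proof.
move=> f /asboolP fu; rewrite /QRpos_inv; case: pselect => [e|/(_ fu)//].
by rewrite /=; case: (cid e).
Qed.

Lemma QRpos_unitP f g : g * f = 1 -> QRpos_unit f.
Proof. by move=> gf; apply/asboolP; exists g. Qed.

Lemma QRpos_inv_out : {in [predC QRpos_unit], QRpos_inv =1 id}.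
Proof.
move=> f /negP fu; rewrite /QRpos_inv; case: pselect => // e.
by exfalso; apply: fu; apply/asboolP.
Qed.

HB.instance Definition _ := GRing.ComNzRing_hasMulInverse.Build QRpos
  QRpos_mulVf QRpos_unitP QRpos_inv_out.

HB.instance Definition _ := GRing.ComUnitRing_isIntegral.Build QRpos
  QRpos_integral.

Lemma lead_exp0 : lead_exp 0 = 0.
Proof. by rewrite /lead_exp big_seq big_pred0// => x; rewrite msupp0. Qed.

Lemma lead_rat0 : lead_rat 0 = 0.
Proof. by rewrite /lead_rat mcoeff0. Qed.

Lemma lead_expM f g : lead_exp (f * g) = lead_exp f * lead_exp g.
Proof.
have [->|/is_lead_ex[p fp]] := eqVneq f 0; first by rewrite mul0r lead_exp0 mul0r.
have [->|/is_lead_ex[q gq]] := eqVneq g 0; first by rewrite mulr0 lead_exp0 mulr0.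
have [h _] := is_leadM fp gq.
by rewrite (lead_expP h) (lead_expP fp) (lead_expP gq).
Qed.

Lemma lead_ratM f g : lead_rat (f * g) = lead_rat f * lead_rat g.
Proof.
have [->|/is_lead_ex[p fp]] := eqVneq f 0; first by rewrite mul0r lead_rat0 mul0r.
have [->|/is_lead_ex[q gq]] := eqVneq g 0; first by rewrite mulr0 lead_rat0 mulr0.
have [h e] := is_leadM fp gq.
by rewrite (lead_ratP h) (lead_ratP fp) (lead_ratP gq).
Qed.

Local Notation "f %:F" := (@FracField.tofrac QRpos f).

Definition fracQRpos : fieldType := {fraction QRpos}.

Definition pos_incl (x : posreal) : QRpos := << 1 *g x >>.

Definition tauW (x : R) : fracQRpos :=
  if 0 < x then (pos_incl (to_pos x))%:F
  else if x < 0 then - (pos_incl (to_pos (- x)))%:F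
  else 0.

Definition rho_ratio f g : R :=
  ratr (Num.sg (lead_rat f / lead_rat g)) * (lead_exp f / lead_exp g).

(* The value does not depend on the fraction representing w: see rhoWE. *)
Definition rhoW (w : fracQRpos) : R :=
  rho_ratio \n_(repr w) \d_(repr w).

Lemma rhoWE f g : g != 0 ->
  rhoW (f%:F / g%:F) = rho_ratio f g.
Proof.
move=> g0; rewrite /rhoW; set w := _ / _; set n := \n_(repr w); set d := \d_(repr w).
have d0 : d != 0 by exact: denom_ratioP.
have wE : w = n%:F / d%:F by exact: fraction_repr.
have fd : f * d = n * g.
  apply/eqP; rewrite -tofrac_eq !tofracM.
  by move: wE; rewrite /w => /eqP; rewrite eqr_div ?tofrac_eq0.
have g1 : lead_rat g != 0 by have [p /lead_rat_neq0] := is_lead_ex g0.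
have d1 : lead_rat d != 0 by have [p /lead_rat_neq0] := is_lead_ex d0.
have lead_exp_neq0 h : h != 0 -> lead_exp h != 0.
  by move=> /is_lead_ex[p /lead_expP ->]; rewrite gt_eqF// (valP p).
have gE := lead_exp_neq0 _ g0; have dE := lead_exp_neq0 _ d0.
rewrite /rho_ratio; congr (ratr (Num.sg _) * _).
  by apply/eqP; rewrite eqr_div// -!lead_ratM -fd.
by apply/eqP; rewrite eqr_div// -!lead_expM -fd.
Qed.

Lemma rhoW0 : rhoW 0 = 0.
Proof.
have := rhoWE 0 (oner_neq0 QRpos); rewrite tofrac0 mul0r => ->.
by rewrite /rho_ratio lead_rat0 mul0r sgr0 rmorph0 mul0r.
Qed.

End PositiveReals.

(* Main.v *)
Require Import Defs.
From HB Require Import structures.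
From mathcomp Require Import all_boot all_order all_algebra.
From mathcomp Require Import finmap.
From mathcomp.multinomials Require Import monalg.
From mathcomp Require Import boolp classical_sets reals.

Set Implicit Arguments.
Unset Strict Implicit.
Unset Printing Implicit Defensive.

Import Order.TTheory GRing.Theory Num.Theory.

Local Open Scope classical_set_scope.
Local Open Scope ring_scope.

(** Why the theorem holds.

    In the real tropical hyperfield a sum is ambiguous only when its two terms
    are opposite: otherwise the term of larger absolute value wins, and x + x is
    x. Hence every homomorphism rho from a field K to it behaves like a signed
    valuation: rho n = 1 for each positive integer n, so K has characteristic 0
    and contains the rationals, on which rho is the sign; and in a finite sum
    where one term has strictly largest absolute value under rho, that term
    determines rho of the sum.

    Let (K, rho, tau) be a W-model. The section tau is forced to be odd,
    tau (- r) = - tau r, so it is determined by its restriction to the positive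
    reals, which is a group homomorphism into the units of K. Together with the
    inclusion of the rationals in K it extends to a ring homomorphism phi from
    the group ring of the positive reals. In phi f, for f = sum_i a_i x_i, the
    term of the largest x_i dominates, so rho (phi f) is the signed leading
    exponent of f (model_rho_eval). This one identity gives everything: phi f is
    nonzero when f is, so phi extends to the field of fractions, and the
    extension carries rho back to rhoW because rhoW is by definition the quotient
    of the signed leading exponents of numerator and denominator. The extension is
    unique because a homomorphism into a field of characteristic 0 is fixed on
    rational multiples of tauW x once it is fixed on tauW x
    (rmorph_tauW_unique).

    That W itself is a W-model rests on signed_leadD: the signed leading exponent
    of f + g lies in the tropical sum of those of f and g. Multiplying by the
    inverse of a common denominator transports this to the field of fractions.

    The isomorphism of the quotient by the kernel uses nothing specific to W: it
    holds for every W-model (quotient_kernel_iso). Two elements with the same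
    image under rho differ by a factor in the kernel, rho is onto because tau is a
    section, and each element of a tropical sum r + s is realised as rho (x + y)
    with rho x = r and rho y = s (model_rho_add_surj). *)

(** * Homomorphisms out of fields of fractions, the rationals and group rings *)

(** Additivity of a map defined through representatives of fractions becomes
    additivity on numerators. *)
Lemma fraction_common_denom (D : idomainType) (x y : {fraction D}) :
  exists f g d, [/\ d != 0, x = FracField.tofrac f / FracField.tofrac d
                  & y = FracField.tofrac g / FracField.tofrac d].
Proof.
have x0 := denom_ratioP (repr x); have y0 := denom_ratioP (repr y).
exists (\n_(repr x) * \d_(repr y)), (\n_(repr y) * \d_(repr x)),
  (\d_(repr x) * \d_(repr y)); split; first by rewrite mulf_neq0.
  by rewrite {1}(fraction_repr x) !tofracM -mulf_div divff ?tofrac_eq0// mulr1.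
rewrite {1}(fraction_repr y) [\d_(repr x) * _]mulrC !tofracM.
by rewrite -mulf_div divff ?tofrac_eq0// mulr1.
Qed.

(** Injectivity keeps the denominators nonzero, so phi n / phi d depends only on
    the fraction n / d. *)
Lemma fraction_rmorph_ext (D : idomainType) (K : fieldType)
    (phi : {rmorphism D -> K}) : (forall d, phi d = 0 -> d = 0) ->
  exists alpha : {rmorphism {fraction D} -> K},
    forall d, alpha (FracField.tofrac d) = phi d.
Proof.
move=> phi_inj.
have phi_neq0 d : d != 0 -> phi d != 0.
  by apply: contra_neq; exact: phi_inj.
pose alpha (w : {fraction D}) : K := phi \n_(repr w) / phi \d_(repr w).
have alphaE f g : g != 0 ->
    alpha (FracField.tofrac f / FracField.tofrac g) = phi f / phi g.
  move=> g0; set w : {fraction D} := _ / _; rewrite /alpha.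
  have d0 : \d_(repr w) != 0 := denom_ratioP _.
  have : w = FracField.tofrac \n_(repr w) / FracField.tofrac \d_(repr w).
    exact: fraction_repr.
  move: d0; set n := \n_(repr w); set d := \d_(repr w) => d0 /eqP.
  rewrite eqr_div ?tofrac_eq0// -!tofracM tofrac_eq => /eqP fd.
  by apply/eqP; rewrite eqr_div ?phi_neq0// -!rmorphM fd.
have alphaF d : alpha (FracField.tofrac d) = phi d.
  by have := alphaE d 1 (oner_neq0 _); rewrite tofrac1 rmorph1 !divr1.
have alphaB : zmod_morphism alpha.
  move=> x y; have [f [g [d [d0 -> ->]]]] := fraction_common_denom x y.
  by rewrite -mulrBl -tofracB !alphaE// rmorphB mulrBl.
have alphaM : monoid_morphism alpha.
  split=> [|x y]; first by rewrite -tofrac1 alphaF rmorph1.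
  have [f [g [d [d0 -> ->]]]] := fraction_common_denom x y.
  rewrite mulf_div -!tofracM !alphaE ?mulf_neq0// !rmorphM.
  by rewrite [RHS]mulf_div.
pose am := GRing.isZmodMorphism.Build _ _ alpha alphaB.
pose mm := GRing.isMonoidMorphism.Build _ _ alpha alphaM.
pose ext : {rmorphism {fraction D} -> K} := HB.pack alpha am mm.
by exists ext.
Qed.

Lemma fraction_rmorph_eq (D : idomainType) (K : fieldType)
    (alpha beta : {rmorphism {fraction D} -> K}) :
  (forall d, alpha (FracField.tofrac d) = beta (FracField.tofrac d)) ->
  alpha =1 beta.
Proof. by move=> h w; rewrite (fraction_repr w) !fmorph_div !h. Qed.

(** In characteristic 0 the image of n / d does not change when n / d is reduced
    to lowest terms, which is all that the morphism laws of [ratr] need. *)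
Lemma ratr_rmorph (K : fieldType) : (forall n : nat, n.+1%:R != 0 :> K) ->
  exists iota : {rmorphism rat -> K}, forall a, iota a = ratr a.
Proof.
move=> K0; have intr_neq0 (d : int) : d != 0 -> d%:~R != 0 :> K.
  by case: d => [[//|n]|n] _; rewrite ?NegzE ?mulrNz ?oppr_eq0; exact: K0.
have ratrE (n d : int) : d != 0 -> ratr (n%:~R / d%:~R) = n%:~R / d%:~R :> K.
  move=> d0; set a := n%:~R / _; apply/eqP.
  rewrite eqr_div ?intr_neq0 ?denq_eq0// -!intrM; apply/eqP; congr _%:~R.
  apply: (@intr_inj rat); rewrite !intrM; apply/eqP.
  by rewrite -eqr_div ?intr_eq0 ?denq_eq0// divq_num_den.
have ratrB : zmod_morphism (@ratr K).
  move=> x y; have [x0 y0] := (denq_neq0 x, denq_neq0 y).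
  rewrite -(divq_num_den x) -(divq_num_den y) -mulNr addf_div ?intr_eq0//.
  rewrite -mulrNz -!intrM -intrD !ratrE ?mulf_neq0// intrD !intrM mulrNz.
  by rewrite -addf_div ?intr_neq0// mulNr.
have ratrM : monoid_morphism (@ratr K).
  split=> [|x y]; first by rewrite /ratr divr1.
  have [x0 y0] := (denq_neq0 x, denq_neq0 y).
  rewrite -(divq_num_den x) -(divq_num_den y) mulf_div.
  by rewrite -!intrM !ratrE ?mulf_neq0// !intrM -mulf_div.
pose am := GRing.isZmodMorphism.Build _ _ (@ratr K) ratrB.
pose mm := GRing.isMonoidMorphism.Build _ _ (@ratr K) ratrM.
pose iota : {rmorphism rat -> K} := HB.pack (@ratr K) am mm.
by exists iota.
Qed.

(** The universal property of the group ring: both products are bilinear, so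
    multiplicativity reduces to single monomials. *)
Lemma group_ring_eval (A : comNzRingType) (G : groupType) (S : comNzRingType)
    (f : {rmorphism A -> S}) (h : G -> S) :
    h 1%g = 1 -> (forall x y, h (x * y)%g = h x * h y) ->
  exists phi : {rmorphism group_ring A G -> S},
    forall a x, phi << a *g x >> = f a * h x.
Proof.
move=> h1 hM; pose phi : group_ring A G -> S := mmap f h.
have phiU a x : phi << a *g x >> = f a * h x by exact: mmapU.
have phiB : zmod_morphism phi by exact: mmap_is_additive.
pose am := GRing.isZmodMorphism.Build _ _ phi phiB.
pose phi' : {additive group_ring A G -> S} := HB.pack phi am.
have phiM : monoid_morphism phi.
  split=> [|u v]; first by rewrite [phi 1]phiU rmorph1 mul1r.
  rewrite [u * v]/(gr_mul u v) -[phi _]/(phi' _) /gr_mul raddf_sum /=.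
  rewrite [phi u]mmapE mulr_suml; apply: eq_bigr => x _.
  rewrite -[phi _]/(phi' _) raddf_sum [phi v]mmapE mulr_sumr.
  by apply: eq_bigr => y _; rewrite /= phiU rmorphM hM mulrACA.
pose mm := GRing.isMonoidMorphism.Build _ _ phi phiM.
pose ev : {rmorphism group_ring A G -> S} := HB.pack phi am mm.
by exists ev.
Qed.

(** * The signed leading exponent *)

Lemma sgr_add_same (R : realDomainType) (a b : R) :
  Num.sg a = Num.sg b -> Num.sg (a + b) = Num.sg a.
Proof.
case: (sgrP a) => ha e; first by rewrite ha add0r.
  by rewrite gtr0_sg// addr_gt0// -sgr_gt0 -e ltr01.
by rewrite ltr0_sg// -oppr_gt0 opprD addr_gt0 ?oppr_gt0// -sgr_lt0 -e oppr_lt0.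
Qed.

Lemma sgr_opp_neq (R : realDomainType) (a b : R) :
  a != 0 -> b != 0 -> Num.sg a != Num.sg b -> Num.sg b = - Num.sg a.
Proof.
by case: (sgrP b) => //; case: (sgrP a) => //; rewrite ?eqxx ?opprK.
Qed.

Section SignedLeading.
Variable R : realType.
Implicit Types f g : QRpos R.
Implicit Types p : posreal R.

(** The value of rhoW at the element f of the group ring. *)
Definition signed_lead f : R := Num.sg (ratr (lead_rat f)) * lead_exp f.

Lemma signed_lead0 : signed_lead 0 = 0.
Proof. by rewrite /signed_lead lead_exp0 mulr0. Qed.

Lemma signed_leadM f g : signed_lead (f * g) = signed_lead f * signed_lead g.
Proof. by rewrite /signed_lead lead_ratM lead_expM rmorphM sgrM mulrACA. Qed.

Lemma signed_leadP f p : is_lead f p ->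
  signed_lead f = Num.sg (ratr f@_p) * val p.
Proof. by move=> fp; rewrite /signed_lead (lead_ratP fp) (lead_expP fp). Qed.

Lemma normr_signed_lead f : `|signed_lead f| = lead_exp f.
Proof.
have [->|/is_lead_ex[p fp]] := eqVneq f 0.
  by rewrite signed_lead0 lead_exp0 normr0.
rewrite (signed_leadP fp) (lead_expP fp) normrM normr_sg fmorph_eq0.
rewrite -(lead_ratP fp) (lead_rat_neq0 fp) mul1r.
by apply/ger0_norm/ltW/(valP p).
Qed.

Lemma signed_lead_eq0 f : (signed_lead f == 0) = (f == 0).
Proof.
apply/idP/idP => [|/eqP->]; last by rewrite signed_lead0.
apply: contraTT => /is_lead_ex[p fp].
by rewrite -normr_eq0 normr_signed_lead (lead_expP fp) gt_eqF// (valP p).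
Qed.

Lemma lead_exp_ge f p : p \in msupp f -> val p <= lead_exp f.
Proof. by move=> pf; exact: le_bigmax_seq. Qed.

Lemma lead_exp_le f (c : R) : 0 <= c ->
  (forall p, p \in msupp f -> val p <= c) -> lead_exp f <= c.
Proof.
move=> c0 fc; have [->|/is_lead_ex[p fp]] := eqVneq f 0; first by rewrite lead_exp0.
by rewrite (lead_expP fp); apply: fc; case: fp.
Qed.

Lemma lead_expD f g : lead_exp (f + g) <= Num.max (lead_exp f) (lead_exp g).
Proof.
apply: lead_exp_le => [|p pfg].
  by rewrite le_max -normr_signed_lead normr_ge0.
rewrite le_max; have /(fsubsetP (msuppD_le f g)) := pfg.
by rewrite in_fsetU => /orP[] /lead_exp_ge ->; rewrite ?orbT.
Qed.

(** If one leading exponent is larger, its monomial also leads f + g. If the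
    exponents agree and the leading coefficients have the same sign, these
    coefficients cannot cancel, and f + g has the same leading exponent and sign.
    If the signs are opposite, the leading exponent of f + g can be anything up to
    that of f, and this is the interval allowed by the tropical sum. *)
Lemma signed_leadD f g :
  trop_add (signed_lead f) (signed_lead g) (signed_lead (f + g)).
Proof.
wlog gf : f g / lead_exp g <= lead_exp f => [hw|].
  have [/hw//|/ltW/hw] := leP (lead_exp g) (lead_exp f).
  by rewrite trop_addC addrC.
have [f0|/is_lead_ex[p fp]] := eqVneq f 0.
  move: gf; rewrite f0 lead_exp0 -normr_signed_lead normr_le0 signed_lead_eq0.
  by move=> /eqP->; rewrite addr0 signed_lead0 trop_add0.
have [pf fub] := fp.
have fgub x : x \in msupp (f + g) -> val x <= val p.
  move=> /lead_exp_ge/le_trans; apply; apply: le_trans (lead_expD _ _) _.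
  by rewrite max_l// (lead_expP fp).
have [gltf|fleg] := ltP (lead_exp g) (lead_exp f).
  have pg : p \notin msupp g.
    by apply/negP => /lead_exp_ge; rewrite leNgt -(lead_expP fp) gltf.
  have fgp : (f + g)@_p = f@_p by rewrite mcoeffD (mcoeff_outdom pg) addr0.
  have fgl : is_lead (f + g) p by split=> //; rewrite -mcoeff_neq0 fgp mcoeff_neq0.
  rewrite (signed_leadP fgl) fgp -(signed_leadP fp).
  by apply: trop_addl; rewrite !normr_signed_lead.
have [g0|/is_lead_ex[q gq]] := eqVneq g 0.
  by rewrite g0 addr0 signed_lead0 trop_add0.
have qp : q = p.
  by apply: val_inj; apply/le_anti; rewrite -(lead_expP fp) -(lead_expP gq) gf fleg.
rewrite {q}qp in gq.
have fp0 : f@_p != 0 by rewrite mcoeff_neq0.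
have gp0 : g@_p != 0 by rewrite mcoeff_neq0; case: gq.
have [fg|fg] := eqVneq (Num.sg (ratr f@_p : R)) (Num.sg (ratr g@_p)).
  have sfg : Num.sg (ratr (f + g)@_p) = Num.sg (ratr f@_p) :> R.
    by rewrite mcoeffD rmorphD sgr_add_same.
  have fgl : is_lead (f + g) p.
    split=> //; rewrite -mcoeff_neq0; apply: contraNneq fp0 => fg0.
    by rewrite -(fmorph_eq0 (@ratr R)) -sgr_eq0 -sfg fg0 rmorph0 sgr0.
  by rewrite (signed_leadP fgl) sfg (signed_leadP fp) (signed_leadP gq) -fg trop_addxx.
have -> : signed_lead g = - signed_lead f.
  rewrite (signed_leadP fp) (signed_leadP gq) -mulNr; congr (_ * _).
  by apply: sgr_opp_neq => //; rewrite fmorph_eq0.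
apply/trop_addN; rewrite !normr_signed_lead.
by rewrite (lead_expP fp); apply: lead_exp_le => //; exact/ltW/(valP p).
Qed.

Lemma signed_leadU (a : rat) (p : posreal R) :
  signed_lead << a *g p >> = Num.sg (ratr a) * val p.
Proof.
have [->|a0] := eqVneq a 0.
  by rewrite monalgU0 signed_lead0 rmorph0 sgr0 mul0r.
have ap : is_lead (<< a *g p >> : QRpos R) p.
  have e : msupp << a *g p >> = [fset p]%fset by rewrite msuppU (negbTE a0).
  by split=> [|x]; rewrite e inE // => /eqP->.
by rewrite (signed_leadP ap) mcoeffUU.
Qed.

Lemma rhoW_frac f g : g != 0 ->
  rhoW (FracField.tofrac f / FracField.tofrac g) = signed_lead f / signed_lead g.
Proof.
move=> g0; rewrite rhoWE// /rho_ratio /signed_lead ratr_sg fmorph_div.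
by rewrite sgrM sgrV -mulf_div invr_sg.
Qed.

Lemma rhoW_tofrac f : rhoW (FracField.tofrac f) = signed_lead f.
Proof.
have := rhoW_frac f (oner_neq0 _); rewrite tofrac1 divr1 => ->.
have -> : (1 : QRpos R) = << 1 *g (1%g : posreal R) >> by [].
by rewrite signed_leadU rmorph1 sgr1 mul1r /= divr1.
Qed.

Lemma rhoWM (x y : fracQRpos R) : rhoW (x * y) = rhoW x * rhoW y.
Proof.
have [f [g [d [d0 -> ->]]]] := fraction_common_denom x y.
rewrite mulf_div -!tofracM !rhoW_frac ?mulf_neq0//.
by rewrite [RHS]mulf_div; congr (_ / _); exact: signed_leadM.
Qed.

(** Over a common denominator the claim is [signed_leadD] multiplied by a
    constant. *)
Lemma rhoWD (x y : fracQRpos R) : trop_add (rhoW x) (rhoW y) (rhoW (x + y)).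
Proof.
have [f [g [d [d0 -> ->]]]] := fraction_common_denom x y.
rewrite -mulrDl -tofracD !rhoW_frac// -!(mulrC (signed_lead d)^-1) -trop_mulDr.
by exists (signed_lead (f + g)) => //; exact: signed_leadD.
Qed.

End SignedLeading.

(** * W-models of the real tropical hyperfield *)

Lemma trop_add_dominant (R : realType) (x y z : R) :
  `|y| < `|x| -> trop_add x y z -> z = x.
Proof. by move=> yx; rewrite /trop_add yx. Qed.

Lemma trop_add_norm_le (R : realType) (x y z : R) :
  trop_add x y z -> `|z| <= Num.max `|x| `|y|.
Proof.
rewrite le_max; case/trop_addE => [[-> _]|[-> _]|[_ ->//]]; rewrite lexx //.
exact: orbT.
Qed.

Section TropicalModel.
Variables (R : realType) (N : W_model (real_tropical R)).

(** The components of N, typed by the field and the reals so that the ring and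
    order structures of both are found. *)
Definition model_rho (x : W_field N) : R := W_rho N x.
Definition model_tau (r : R) : W_field N := W_tau N r.

Local Notation K := (W_field N).
Local Notation rho := model_rho.
Local Notation tau := model_tau.
Implicit Types (x y : K) (r s : R).

Lemma model_rho0 : rho 0 = 0.
Proof. by case: (W_rho_hom N). Qed.

Lemma model_rho1 : rho 1 = 1.
Proof. by case: (W_rho_hom N). Qed.

Lemma model_rhoM x y : rho (x * y) = rho x * rho y.
Proof. by case: (W_rho_hom N) => _ _ + _; apply. Qed.

Lemma model_rhoD x y : trop_add (rho x) (rho y) (rho (x + y)).
Proof. by case: (W_rho_hom N) => _ _ _ /(_ x y); apply; exists (x + y). Qed.

Lemma model_tauM r s : tau (r * s) = tau r * tau s.
Proof. exact: (@W_tauM _ N). Qed.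

Lemma model_tauK : cancel tau rho.
Proof. exact: (@W_tauK _ N). Qed.

Lemma model_rhoN x : rho (- x) = - rho x.
Proof. by apply: trop_opp; rewrite -model_rho0 -(subrr x); exact: model_rhoD. Qed.

Lemma model_rho_eq0 x : (rho x == 0) = (x == 0).
Proof.
apply/idP/idP => [|/eqP->]; last by rewrite model_rho0.
apply: contraTT => x0; apply/eqP => rx0; have := model_rho1.
by rewrite -(divff x0) model_rhoM rx0 mul0r => /esym/eqP; rewrite oner_eq0.
Qed.

Lemma model_rho_div x y : rho (x / y) = rho x / rho y.
Proof.
have [->|y0] := eqVneq y 0; first by rewrite invr0 mulr0 model_rho0 invr0 mulr0.
by apply: (canRL (mulfK _)); rewrite ?model_rho_eq0// -model_rhoM divfK.
Qed.

Lemma model_tau0 : tau 0 = 0.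
Proof. by apply/eqP; rewrite -model_rho_eq0 model_tauK. Qed.

Lemma model_tau_neq0 r : r != 0 -> tau r != 0.
Proof. by rewrite -model_rho_eq0 model_tauK. Qed.

Lemma model_tau1 : tau 1 = 1.
Proof. by apply: (mulfI (model_tau_neq0 (oner_neq0 R))); rewrite -model_tauM !mulr1. Qed.

(** The square of tau (-1) is 1, and tau (-1) is not 1 because tau is
    injective. *)
Lemma model_tauN r : tau (- r) = - tau r.
Proof.
suff tauN1 : tau (- 1) = - 1 by rewrite -mulN1r model_tauM tauN1 mulN1r.
have /eqP : tau (- 1) ^+ 2 = 1 by rewrite expr2 -model_tauM mulrNN mulr1 model_tau1.
rewrite sqrf_eq1 => /orP[|/eqP//]; rewrite -model_tau1 => /eqP/(can_inj model_tauK)/eqP.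
by rewrite eqNr oner_eq0.
Qed.

(** The tropical sum 1 + 1 is {1}. *)
Lemma model_rho_natS n : rho n.+1%:R = 1.
Proof.
elim: n => [|n ih]; first exact: model_rho1.
by have := model_rhoD n.+1%:R 1; rewrite natr1 ih model_rho1 trop_addxx.
Qed.

Lemma model_natS_neq0 n : n.+1%:R != 0 :> K.
Proof. by rewrite -model_rho_eq0 model_rho_natS oner_neq0. Qed.

(** A homomorphism to the real tropical hyperfield sees only the sign of a
    rational: every positive integer goes to 1. *)
Lemma model_rho_ratr (a : rat) : rho (ratr a) = Num.sg (ratr a).
Proof.
have rho_int (m : int) : rho m%:~R = Num.sg m%:~R.
  case: m => [[|n]|n]; first by rewrite model_rho0 sgr0.
    by rewrite -pmulrn model_rho_natS gtr0_sg.
  by rewrite NegzE !mulrNz model_rhoN model_rho_natS sgrN gtr0_sg.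
rewrite /ratr model_rho_div !rho_int sgrM sgrV; congr (_ * _).
by rewrite gtr0_sg ?ltr0z ?denq_gt0// invr1.
Qed.

(** The ultrametric inequality, in the strict form that makes a dominant term
    stay dominant over the sum of all the others. *)
Lemma model_rho_sum_lt (I : Type) (r : seq I) (P : pred I) (F : I -> K) (c : R) :
  0 < c -> (forall i, P i -> `|rho (F i)| < c) ->
  `|rho (\sum_(i <- r | P i) F i)| < c.
Proof.
move=> c0 Fc; apply: (big_ind (fun x => `|rho x| < c)) => //.
  by rewrite model_rho0 normr0.
move=> x y xc yc; apply: le_lt_trans (trop_add_norm_le (model_rhoD x y)) _.
by rewrite gt_max xc yc.
Qed.

(** The term of the leading monomial strictly dominates all the others, hence
    their sum, so it alone decides the value of rho. *)
Lemma model_rho_eval (phi : {rmorphism QRpos R -> K}) :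
  (forall a p, phi << a *g p >> = ratr a * tau (val p)) ->
  forall f, rho (phi f) = signed_lead f.
Proof.
move=> phiU f; have rhoU a p : rho (phi << a *g p >>) = signed_lead << a *g p >>.
  by rewrite phiU model_rhoM model_rho_ratr model_tauK signed_leadU.
have [->|/is_lead_ex[p fp]] := eqVneq f 0.
  by rewrite rmorph0 model_rho0 signed_lead0.
have [pf fub] := fp; have p0 : 0 < val p := valP p.
have fE : f = << f@_p *g p >> + \sum_(q <- (msupp f `\ p)%fset) << f@_q *g q >>.
  by rewrite {1}(monalgE f) (big_fsetD1 p).
have lE : signed_lead f = signed_lead << f@_p *g p >>.
  by rewrite (signed_leadP fp) signed_leadU.
rewrite lE -rhoU; apply: trop_add_dominant; last first.
  by rewrite {3}fE rmorphD; exact: model_rhoD.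
have -> : `|rho (phi << f@_p *g p >>)| = val p.
  by rewrite rhoU -lE normr_signed_lead (lead_expP fp).
rewrite rmorph_sum big_seq; apply: model_rho_sum_lt => // q.
rewrite in_fsetD1 => /andP[qp qf].
rewrite rhoU signed_leadU normrM normr_sg fmorph_eq0.
rewrite mcoeff_neq0 qf mul1r (gtr0_norm (valP q)) lt_neqAle fub// andbT.
by apply: contraNneq qp => /val_inj->.
Qed.

(** Outside the ambiguous case any representatives work. In r + (- r), an element
    t with |t| < |r| is reached by adding tau t to tau r, which rho cannot
    detect, and then subtracting tau r. For t = r or t = - r the correction is
    tau r itself, added to the representative whose sign survives: rho (2 tau r)
    is still r. *)
Lemma model_rho_add_surj r s t : trop_add r s t ->
  exists x y, [/\ rho x = r, rho y = s & rho (x + y) = t].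
Proof.
case/trop_addE => [[-> h]|[-> h]|[-> ]].
- exists (tau r), (tau s); rewrite !model_tauK; split=> //.
  have := model_rhoD (tau r) (tau s); rewrite !model_tauK; case: h => [|<-].
    exact: trop_add_dominant.
  by rewrite trop_addxx.
- exists (tau r), (tau s); rewrite !model_tauK; split=> //.
  have := model_rhoD (tau r) (tau s); rewrite !model_tauK trop_addC.
  exact: trop_add_dominant.
- have absorb u v : `|v| < `|u| \/ u = v -> rho (tau u + tau v) = u.
    have := model_rhoD (tau u) (tau v); rewrite !model_tauK => uv [|vu].
      by move/trop_add_dominant; apply.
    by move: uv; rewrite -vu trop_addxx.
  rewrite le_eqVlt => /orP[|tr].
    rewrite eqr_norm2 => /orP[]/eqP->.
      exists (tau r + tau r), (- tau r).
      by rewrite model_rhoN addrK !model_tauK absorb//; right.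
    exists (tau r), (- (tau r + tau r)).
    rewrite model_rhoN opprD addrA subrr add0r model_rhoN !model_tauK absorb//.
    by right.
  exists (tau r + tau t), (- tau r).
  by rewrite model_rhoN addrAC subrr add0r !model_tauK absorb//; left.
Qed.

End TropicalModel.

(** * The quotient by the kernel *)

Section Quotient.
Variables (R : realType) (N : W_model (real_tropical R)).
Local Notation G := (kernel (W_rho_hom N)).

(** For x and y nonzero the quotient y / x lies in the kernel; zero is alone in
    its fibre. *)
Lemma model_rho_orbit (x y : W_field N) :
  to_orbit G x = to_orbit G y <-> model_rho x = model_rho y.
Proof.
split=> [/to_orbitP[g [_ g1] ->]|xy].
  by rewrite model_rhoM [model_rho g]g1 mulr1.
apply/to_orbitP; have [x0|x0] := eqVneq x 0.
  exists 1; first exact: usg1.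
  by apply/eqP; rewrite mulr1 x0 -model_rho_eq0 -xy x0 model_rho0.
exists (y / x); last by rewrite mulrC divfK.
have y0 : y != 0 by rewrite -model_rho_eq0 -xy model_rho_eq0.
split; first by rewrite mulf_neq0 ?invr_eq0.
by rewrite -[W_rho _ _]/(model_rho (y / x)) model_rho_div xy divff ?model_rho_eq0.
Qed.

Lemma quotient_kernel_iso :
  exists f : quotient_hyperfield G -> real_tropical R,
    hyper_iso f /\ forall x, f (to_orbit G x) = model_rho x.
Proof.
pose f (A : unit_orbits G) : R := model_rho (projT1 (cid (to_orbit_surj A))).
have fE x : f (to_orbit G x) = model_rho x.
  by rewrite /f; case: cid => y /= /model_rho_orbit.
have fD (A B : quotient_hyperfield G) :
    f @` quot_add A B = trop_add (f A) (f B).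
  have [a ->] := to_orbit_surj A; have [b ->] := to_orbit_surj B; rewrite !fE.
  apply/seteqP; split=> [_ [C + <-]|t abt].
    have [c ->] := to_orbit_surj C => /quot_addP[g [h [[_ g1] [_ h1] ->]]].
    rewrite fE; have := model_rhoD (a * g) (b * h).
    by rewrite !model_rhoM [model_rho g]g1 [model_rho h]h1 !mulr1.
  have [x [y [xa yb xyt]]] := model_rho_add_surj N abt.
  exists (to_orbit G (x + y)); last by rewrite fE.
  move/model_rho_orbit: xa => <-; move/model_rho_orbit: yb => <-.
  by apply/quot_addP; exists 1, 1; rewrite !mulr1; split=> //; exact: usg1.
exists f; split=> //; split=> //.
- split.
  + by rewrite -[hzero]/(to_orbit G 0) fE model_rho0.
  + by rewrite -[hone]/(to_orbit G 1) fE model_rho1.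
  + move=> A B; have [a ->] := to_orbit_surj A; have [b ->] := to_orbit_surj B.
    by rewrite -[hmul _ _]/(quot_mul _ _) to_orbitM !fE model_rhoM.
  + by move=> A B; rewrite -[hadd A B]/(quot_add A B) fD.
- exists (fun r => to_orbit G (model_tau N r)).
    move=> A; have [a ->] := to_orbit_surj A.
    by apply/model_rho_orbit; rewrite model_tauK fE.
  by move=> r; rewrite fE model_tauK.
Qed.

End Quotient.

(** * The triple (W, rhoW, tauW) is a W-model *)

Section TauW.
Variable R : realType.
Implicit Types r s : R.

Lemma tauW_gt0 r : 0 < r -> tauW r = FracField.tofrac (pos_incl (to_pos r)).
Proof. by rewrite /tauW => ->. Qed.

Lemma tauW0 : tauW (0 : R) = 0.
Proof. by rewrite /tauW ltxx. Qed.

Lemma tauWN r : tauW (- r) = - tauW r.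
Proof.
rewrite /tauW oppr_gt0 oppr_lt0 opprK.
by case: ltgtP => _; rewrite ?opprK ?oppr0.
Qed.

Lemma tauWM r s : tauW (r * s) = tauW r * tauW s.
Proof.
have pos a b : 0 < a -> 0 < b -> tauW (a * b) = tauW a * tauW b :> fracQRpos R.
  move=> a0 b0; rewrite !tauW_gt0 ?mulr_gt0// -tofracM; congr FracField.tofrac.
  rewrite /pos_incl -[RHS]/(gr_mul _ _) gr_mulUU mulr1; congr << _ *g _ >>.
  by apply: val_inj; rewrite /= !to_posK ?mulr_gt0.
have posl a b : 0 < a -> tauW (a * b) = tauW a * tauW b :> fracQRpos R.
  move=> a0; have [b0|b0|->] := ltgtP b 0; last by rewrite mulr0 tauW0 mulr0.
    by apply: oppr_inj; rewrite -tauWN -mulrN pos ?oppr_gt0// tauWN mulrN.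
  exact: pos.
have [r0|r0|->] := ltgtP r 0; last by rewrite mul0r tauW0 mul0r.
  by apply: oppr_inj; rewrite -tauWN -mulNr posl ?oppr_gt0// tauWN mulNr.
exact: posl.
Qed.

Lemma tauWK : cancel (@tauW R) (@rhoW R).
Proof.
have pos (a : R) : 0 < a -> rhoW (tauW a) = a.
  move=> a0; rewrite tauW_gt0// rhoW_tofrac signed_leadU rmorph1 sgr1 mul1r.
  exact: to_posK.
move=> r; have [r0|r0|->] := ltgtP r 0; last by rewrite tauW0 rhoW0.
  rewrite -[in tauW r](opprK r) tauWN; apply: oppr_inj.
  rewrite -[RHS]pos ?oppr_gt0//; apply/esym/trop_opp.
  by have := rhoWD (- tauW (- r)) (tauW (- r)); rewrite addNr rhoW0.
exact: pos.
Qed.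

Lemma rhoW_hom : @hyper_hom (field_hyperfield (fracQRpos R))
                   (real_tropical R) (@rhoW R).
Proof.
split; [exact: rhoW0 | | exact: rhoWM | ].
  have t1 : tauW (1 : R) = 1.
    have e : to_pos (1 : R) = 1%g by apply: val_inj; rewrite to_posK.
    by rewrite tauW_gt0// e -tofrac1.
  by rewrite -[hone in LHS]/(1 : fracQRpos R) -t1 tauWK.
by move=> x y _ [_ -> <-]; exact: rhoWD.
Qed.

End TauW.

(** * Universality *)

Section Universal.
Variables (R : realType) (N : W_model (real_tropical R)).

(** Multiplying the monomial a x by the denominator of a leaves an integer
    multiple of tauW x; as the denominator is invertible in the field of N, the
    value of a homomorphism at a x follows from its value at tauW x. *)
Lemma rmorph_tauW_unique (alpha beta : {rmorphism fracQRpos R -> W_field N}) :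
  (forall r, alpha (tauW r) = beta (tauW r)) -> alpha =1 beta.
Proof.
move=> ab; apply: fraction_rmorph_eq => f.
have den (gam : {rmorphism fracQRpos R -> W_field N}) a (p : posreal R) :
    gam (FracField.tofrac (<< a *g p >> : QRpos R)) * (denq a)%:~R =
    gam (tauW (val p)) * (numq a)%:~R.
  have gamMz (g : QRpos R) m :
    gam (FracField.tofrac g) * m%:~R = gam (FracField.tofrac (g *~ m)).
    by rewrite mulrzr !raddfMz.
  rewrite tauW_gt0 ?(valP p)// valK_pos !gamMz /pos_incl -!raddfMz /=.
  by rewrite -mulrzr -numqE.
rewrite (monalgE f) !rmorph_sum /=; apply: eq_bigr => p _.
have d0 : (denq f@_p)%:~R != 0 :> W_field N.
  have := denq_gt0 f@_p; case: (denq _) => // -[//|n] _.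
  exact: model_natS_neq0.
by apply: (mulIf d0); rewrite !den ab.
Qed.

(** By [model_rho_eval] the evaluation map phi does not kill any nonzero f, since
    its signed leading exponent is nonzero; so phi extends to fractions, and the
    same identity compares rhoW with rho. *)
Lemma rmorph_from_W : exists2 alpha : {rmorphism fracQRpos R -> W_field N},
  forall r, model_tau N r = alpha (tauW r) &
  forall x, rhoW x = model_rho (alpha x).
Proof.
have [iota iotaE] := ratr_rmorph (@model_natS_neq0 _ N).
have [phi phiU] := @group_ring_eval _ _ _ iota
  (fun p : posreal R => model_tau N (val p)) (model_tau1 N) (fun p q => model_tauM N _ _).
have rho_phi : forall f : QRpos R, model_rho (phi f) = signed_lead f.
  by apply: model_rho_eval => a p; rewrite phiU iotaE.
have [|alpha alphaF] := @fraction_rmorph_ext (QRpos R) (W_field N) phi.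
  by move=> f f0; apply/eqP; rewrite -signed_lead_eq0 -rho_phi f0 model_rho0.
exists alpha => [r|x].
  have pos (a : R) : 0 < a -> model_tau N a = alpha (tauW a).
    by move=> a0; rewrite tauW_gt0// alphaF phiU to_posK// rmorph1 mul1r.
  have [r0|r0|->] := ltgtP r 0; last by rewrite tauW0 rmorph0 model_tau0.
    by apply: oppr_inj; rewrite -model_tauN pos ?oppr_gt0// tauWN rmorphN.
  exact: pos.
rewrite (fraction_repr x) rhoW_frac ?denom_ratioP//.
by rewrite fmorph_div model_rho_div !alphaF !rho_phi.
Qed.

End Universal.

Theorem theorem3p4 (R : realType) :
  exists (rho_hom : @hyper_hom (field_hyperfield (fracQRpos R))
                               (real_tropical R) (@rhoW R))
         (tauM : forall x y : real_tropical R,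
                   tauW (hmul x y) = tauW x * tauW y)
         (tauK : cancel (@tauW R) (@rhoW R)),
    universal_W_model (WModel rho_hom tauM tauK) /\
    exists f : quotient_hyperfield (kernel rho_hom) -> real_tropical R,
      hyper_iso f /\ forall w, f (to_orbit (kernel rho_hom) w) = rhoW w.
Proof.
exists (rhoW_hom R), (@tauWM R), (@tauWK R); split; last first.
  exact: quotient_kernel_iso (WModel (rhoW_hom R) (@tauWM R) (@tauWK R)).
move=> N; have [alpha alpha_tau alpha_rho] := rmorph_from_W N.
exists alpha => // beta [beta_tau _].
by apply: rmorph_tauW_unique => r; rewrite -alpha_tau; exact/esym/beta_tau.
Qed.
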